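(* For $i=1,2$ consider forward complete systems $\Sigma_i:\ \frac{d}{dt}x_i(t)=f_i(x_i(t),w_i(t))$ with $x_i(0)\in\mathbb{R}^{n_i}$, $w_i\in\mathcal{W}^{m_i}$, where $f_i:\mathbb{R}^{n_i}\times\mathbb{R}^{m_i}\to\mathbb{R}^{n_i}$ is locally Lipschitz in its first argument, locally uniformly in its second argument, and $m_1=n_2$, $m_2=n_1$. Suppose both systems are ISS with functions $\alpha_i,\beta_i,\sigma_i\in\mathcal{K}_\infty$: $$\int_0^t\alpha_i(|x_i(\tau)|)d\tau\le\max\left\{\beta_i(|x_i(0)|),\int_0^t\sigma_i(|w_i(\tau)|)d\tau\right\}$$ for all $x_i(0)\in\mathbb{R}^{n_i}$, $w_i\in\mathcal{W}^{m_i}$, $t\ge0$. Suppose the systems are connected in feedback with $w_1=x_2$ and $w_2=x_1$, and this interconnection is forward complete. Let $T_i:\mathbb{R}^{n_i}\to\mathbb{R}^{n_i}$ and $S_i:\mathbb{R}^{m_i}\to\mathbb{R}^{m_i}$, $i=1,2$, be changes of coordinates in which $\Sigma_1$ and $\Sigma_2$ satisfy linear $\mathcal{L}_2$-gain bounds with gain $\bar\gamma=1$, i.e. for some $\hat\beta_i\in\mathcal{K}_\infty$, $$\|T_i(x_i)\|_{\mathcal{L}_2[0,t]}^2\le\max\left\{\hat\beta_i(|T_i(x_i(0))|),\ \|S_i(w_i)\|_{\mathcal{L}_2[0,t]}^2\right\}$$ for all $x_i(0)\in\mathbb{R}^{n_i}$, $w_i\in\mathcal{W}^{m_i}$, $t\ge0$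 (for ISS systems such changes of coordinates always exist). If there exist $c_1,c_2>0$ such that, for $i,j=1,2$, $i\neq j$, $$|S_j(\zeta)|\le\sqrt{c_i}\,|T_i(\zeta)|\quad\text{for all }\zeta\in\mathbb{R}^{n_i},$$ and if $c_1c_2<1$, then the feedback interconnection is $\alpha$-integrable; that is, there exist $\alpha,\beta\in\mathcal{K}_\infty$ such that, with $x=[x_1^T\ x_2^T]^T$, $\int_0^t\alpha(|x(\tau)|)d\tau\le\beta(|x(0)|)$ for all $x(0)\in\mathbb{R}^{n_1+n_2}$ and $t\ge0$.
   Context: $\mathcal{W}^m$ is the set of measurable, locally essentially bounded functions $w:\mathbb{R}_{\ge0}\to\mathbb{R}^m$. Forward complete means that for every initial condition and every input in the input class (if any) the solution exists for all $t\ge 0$. $\mathcal{K}_\infty$ is the class of continuous, strictly increasing, unbounded functions $\alpha:\mathbb{R}_{\ge0}\to\mathbb{R}_{\ge0}$ with $\alpha(0)=0$. $|\cdot|$ is the Euclidean norm, and $\|y\|_{\mathcal{L}_2[0,t]}^2:=\int_0^t|y(\tau)|^2d\tau$; $T_i(x_i)$ and $S_i(w_i)$ denote the functions $\tau\mapsto T_i(x_i(\tau))$ and $\tau\mapsto S_i(w_i(\tau))$. A change of coordinates is a homeomorphism $T:\mathbb{R}^p\to\mathbb{R}^p$ with $T(0)=0$ (differentiability is not required). ISS stands for input-to-state stable. *)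

(* Defs.v *)
From HB Require Import structures.
From mathcomp Require Import all_boot all_order all_algebra.
From mathcomp Require Import all_classical all_reals all_analysis.
Set Implicit Arguments.
Unset Strict Implicit.
Unset Printing Implicit Defensive.
Import Order.TTheory GRing.Theory Num.Theory.
Import numFieldNormedType.Exports.
Local Open Scope classical_set_scope.
Local Open Scope ring_scope.

(* Functions of time are total functions on R; only their values on
   [0, +oo[ are constrained or used. *)

(* Carrier R with the sigma-algebra of Lebesgue-measurable (not just Borel)
   sets, on which completed_lebesgue_measure is defined. *)
Notation lebesgueR R :=
  (caratheodory_type (mu_ext (wlength (R := R) idfun))).

(* The norm that the library puts on matrices is the sup norm; it induces the
   same topology. *)
Definition enorm (R : realType) (n : nat) (v : 'cV[R]_n) : R :=
  Num.sqrt (\sum_(i < n) v i ord0 ^+ 2).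

Definition time_int (R : realType) (t : R) (g : R -> R) : \bar R :=
  (\int[completed_lebesgue_measure]_(s in [set s : lebesgueR R | (0 <= s <= t)%R])
     (g s)%:E)%E.

Definition sqnormL2 (R : realType) (n : nat) (t : R) (y : R -> 'cV[R]_n)
    : \bar R :=
  time_int t (fun s => enorm (y s) ^+ 2).

Definition class_Kinfty (R : realType) (a : R -> R) : Prop :=
  [/\ {within `[0, +oo[, continuous a},
      forall r s, 0 <= r -> r < s -> a r < a s,
      a 0 = 0 &
      forall M, exists2 r, 0 <= r & M < a r].

Definition change_of_coordinates (R : realType) (p : nat)
    (T : 'cV[R]_p -> 'cV[R]_p) : Prop :=
  T 0 = 0 /\
  exists Tinv, [/\ cancel T Tinv, cancel Tinv T, continuous T & continuous Tinv].

Definition input_class (R : realType) (m : nat) : set (R -> 'cV[R]_m) :=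
  [set w : R -> 'cV[R]_m |
    (forall i, measurable_fun [set t : lebesgueR R | 0 <= t]
                 (fun t => w t i ord0 : measurableTypeR R)) /\
    (forall b : R, exists M : R,
       {ae completed_lebesgue_measure,
         forall t : lebesgueR R, 0 <= t <= b -> enorm (w t) <= M})].

Definition locally_lipschitz_state (R : realType) (n m : nat)
    (f : 'cV[R]_n -> 'cV[R]_m -> 'cV[R]_n) : Prop :=
  forall x0 w0, exists L d : R, 0 < d /\
    forall x y w, enorm (x - x0) < d -> enorm (y - x0) < d ->
      enorm (w - w0) < d -> enorm (f x w - f y w) <= L * enorm (x - y).

Definition absolutely_continuous_on (R : realType) (n : nat) (a b : R)
    (x : R -> 'cV[R]_n) : Prop :=
  forall e : R, 0 < e -> exists2 d : R, 0 < d &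
    forall (N : nat) (l u : 'I_N -> R),
      (forall k, a <= l k <= u k /\ u k <= b) ->
      (forall k k', k != k' -> u k <= l k' \/ u k' <= l k) ->
      \sum_(k < N) (u k - l k) < d ->
      \sum_(k < N) enorm (x (u k) - x (l k)) < e.

(* Caratheodory solutions on [0, +oo[ of dx/dt = f(x, w). *)
Definition solution (R : realType) (n m : nat)
    (f : 'cV[R]_n -> 'cV[R]_m -> 'cV[R]_n)
    (w : R -> 'cV[R]_m) (x : R -> 'cV[R]_n) : Prop :=
  (forall b, 0 <= b -> absolutely_continuous_on 0 b x) /\
  {ae completed_lebesgue_measure,
    forall t : lebesgueR R, 0 <= t -> is_derive (t : R) 1 x (f (x t) (w t))}.

Definition forward_complete (R : realType) (n m : nat)
    (f : 'cV[R]_n -> 'cV[R]_m -> 'cV[R]_n) : Prop :=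
  forall (x0 : 'cV[R]_n) w, input_class w ->
    exists2 x, solution f w x & x 0 = x0.

Definition ISS_with (R : realType) (n m : nat)
    (f : 'cV[R]_n -> 'cV[R]_m -> 'cV[R]_n) (alpha beta sigma : R -> R) : Prop :=
  forall w x, input_class w -> solution f w x ->
  forall t, 0 <= t ->
    (time_int t (fun s => alpha (enorm (x s)))
     <= maxe (beta (enorm (x 0%R)))%:E
             (time_int t (fun s => sigma (enorm (w s)))))%E.

Definition unit_L2_gain_in (R : realType) (n m : nat)
    (f : 'cV[R]_n -> 'cV[R]_m -> 'cV[R]_n)
    (T : 'cV[R]_n -> 'cV[R]_n) (S : 'cV[R]_m -> 'cV[R]_m)
    (beta : R -> R) : Prop :=
  forall w x, input_class w -> solution f w x ->
  forall t, 0 <= t ->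
    (sqnormL2 t (T \o x)
     <= maxe (beta (enorm (T (x 0%R))))%:E (sqnormL2 t (S \o w)))%E.

Definition feedback_solution (R : realType) (n1 n2 : nat)
    (f1 : 'cV[R]_n1 -> 'cV[R]_n2 -> 'cV[R]_n1)
    (f2 : 'cV[R]_n2 -> 'cV[R]_n1 -> 'cV[R]_n2)
    (x1 : R -> 'cV[R]_n1) (x2 : R -> 'cV[R]_n2) : Prop :=
  solution f1 x2 x1 /\ solution f2 x1 x2.

Definition feedback_forward_complete (R : realType) (n1 n2 : nat)
    (f1 : 'cV[R]_n1 -> 'cV[R]_n2 -> 'cV[R]_n1)
    (f2 : 'cV[R]_n2 -> 'cV[R]_n1 -> 'cV[R]_n2) : Prop :=
  forall (x10 : 'cV[R]_n1) (x20 : 'cV[R]_n2), exists x1 x2,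
    [/\ feedback_solution f1 f2 x1 x2, x1 0 = x10 & x2 0 = x20].

Definition feedback_alpha_integrable (R : realType) (n1 n2 : nat)
    (f1 : 'cV[R]_n1 -> 'cV[R]_n2 -> 'cV[R]_n1)
    (f2 : 'cV[R]_n2 -> 'cV[R]_n1 -> 'cV[R]_n2) : Prop :=
  exists alpha beta : R -> R,
    [/\ class_Kinfty alpha, class_Kinfty beta &
      forall x1 x2, feedback_solution f1 f2 x1 x2 ->
      let x t := col_mx (x1 t) (x2 t) in
      forall t, 0 <= t ->
        (time_int t (fun s => alpha (enorm (x s)))
         <= (beta (enorm (x 0%R)))%:E)%E].

(* Main.v *)
(* Summing the two gain bounds around the loop, the smallness of c1 c2 absorbs
   the returned integral (finite, because trajectories are continuous), so that
   int |T1 x1|^2 + |T2 x2|^2 is bounded by a function of (T1 x1(0), T2 x2(0)).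
   To return to the original coordinates, call h dominated by g when h is small
   wherever g is small and h is bounded wherever g is bounded. Domination of
   nonnegative functions yields a and b of class K_infinity with a(h) <= g and
   h <= b(g). Since a change of coordinates is a homeomorphism fixing 0, |z| and
   |T z| dominate each other. *)

Require Import Defs.
From HB Require Import structures.
From mathcomp Require Import all_boot all_order all_algebra.
From mathcomp Require Import all_classical all_reals all_analysis.
From mathcomp Require Import measurable_realfun lra.
Set Implicit Arguments.
Unset Strict Implicit.
Unset Printing Implicit Defensive.
Import Order.TTheory GRing.Theory Num.Theory.
Import numFieldNormedType.Exports.
Local Open Scope classical_set_scope.
Local Open Scope ring_scope.

(** * Functions of class K-infinity and their inverses *)

Section Kinfty.
Context {R : realType}.
Implicit Types (a b : R -> R).

Lemma Kinfty_le a r s : class_Kinfty a -> 0 <= r -> r <= s -> a r <= a s.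
Proof.
case=> _ a_incr _ _ r0; rewrite le_eqVlt => /predU1P[->//|rs].
exact/ltW/a_incr.
Qed.

Lemma Kinfty_ge0 a r : class_Kinfty a -> 0 <= r -> 0 <= a r.
Proof. by move=> Ka r0; case: (Ka) => _ _ <- _; exact: Kinfty_le. Qed.

Lemma Kinfty_lt_inv a r s : class_Kinfty a -> 0 <= s -> a r < a s -> r < s.
Proof.
move=> Ka s0; apply: contraTT; rewrite -!leNgt => sr; exact: Kinfty_le.
Qed.

Lemma Kinfty_surj a r : class_Kinfty a -> 0 <= r -> exists2 s, 0 <= s & a s = r.
Proof.
move=> Ka r0; case: (Ka) => ca _ a0 /(_ r)[M M0 rM].
have [||s] := @IVT R a 0 M r M0.
- apply: continuous_subspaceW ca => x /=; rewrite !in_itv/= => /andP[-> _].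
  by [].
- by rewrite a0 ge_min r0 /= le_max (ltW rM) orbT.
by rewrite in_itv/= => /andP[s0 _] <-; exists s.
Qed.

Lemma maxr0_dist (r s : R) : `|Num.max 0 r - Num.max 0 s| <= `|r - s|.
Proof.
rewrite /Num.max; case: ltP => ?; case: ltP => ?; rewrite ler_norml;
  case: (ger0P (r - s)) => ?; apply/andP; split; lra.
Qed.

(** The clamp [Num.max 0] is the identity on [[0, +oo[], so relative continuity can be checked on
    the whole line. *)
Lemma within_continuous_maxr0 a :
  continuous (a \o Num.max 0) -> {within `[0, +oo[, continuous a}.
Proof.
move=> ca; apply: (@subspace_eq_continuous _ _ _ (a \o Num.max 0)).
  move=> x; rewrite inE /= in_itv/= andbT => x0.
  by rewrite /from_subspace/= max_r.
exact: continuous_subspaceT.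
Qed.

(** Continuity of the inverse comes from strict monotonicity: with [s = b r], values strictly
    between [a (s - e)] and [a (s + e)] are sent by [b] within [e] of [s]. *)
Lemma Kinfty_inverse a : class_Kinfty a ->
  exists2 b, class_Kinfty b & forall r, 0 <= r -> b (a r) = r.
Proof.
move=> Ka; case: (Ka) => _ a_incr a0 _.
(* Negative arguments receive the dummy value 0. *)
have /choice[b bP] : forall r, exists s, 0 <= r -> 0 <= s /\ a s = r.
  move=> r; case: (boolP (0 <= r)) => [r0|_]; last by exists 0.
  by have [s] := Kinfty_surj Ka r0; exists s.
have b0 r : 0 <= r -> 0 <= b r by move=> /bP[].
have bK r : 0 <= r -> a (b r) = r by move=> /bP[].
have aK r : 0 <= r -> b (a r) = r.
  move=> r0; have ar0 := Kinfty_ge0 Ka r0.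
  case: (ltgtP (b (a r)) r) => // [|] /a_incr.
    by move=> /(_ (b0 _ ar0)); rewrite bK// ltxx.
  by move=> /(_ r0); rewrite bK// ltxx.
exists b => //; split.
- apply: within_continuous_maxr0 => r; apply/cvgrPdist_lt => e e0 /=.
  have r0 : 0 <= Num.max 0 r by rewrite le_max lexx.
  set s := b (Num.max 0 r).
  have s0 : 0 <= s := b0 _ r0.
  have as_ : a s = Num.max 0 r by exact: bK.
  pose d1 := a (s + e) - Num.max 0 r.
  have d1_gt0 : 0 < d1 by rewrite subr_gt0 -as_ a_incr// ltrDl.
  (* If [s < e], then [s - e] is outside the domain of [a]; the lower bound then follows from
     [b >= 0], and 1 is a placeholder. *)
  pose d2 := if e <= s then Num.max 0 r - a (s - e) else 1.
  have d2_gt0 : 0 < d2.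
    rewrite /d2; case: ifP => // es; rewrite subr_gt0 -as_ a_incr ?subr_ge0//.
    by rewrite ltrBlDr ltrDl.
  near=> t.
  have t0 : 0 <= Num.max 0 t by rewrite le_max lexx.
  have : `|Num.max 0 r - Num.max 0 t| < Num.min d1 d2.
    apply: le_lt_trans (maxr0_dist _ _) _; near: t.
    by apply: cvgr_dist_lt; [exact: cvg_id|rewrite lt_min d1_gt0].
  rewrite lt_min !ltr_norml => /andP[/andP[h1 _] /andP[_ h2]].
  apply/andP; split.
    suff : b (Num.max 0 t) < s + e by lra.
    apply: (Kinfty_lt_inv Ka); first by lra.
    by rewrite bK//; move: h1; rewrite /d1; lra.
  suff : s - e < b (Num.max 0 t) by lra.
  case: (leP e s) => es; last first.
    by apply: lt_le_trans (b0 _ t0); rewrite subr_lt0.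
  apply: (Kinfty_lt_inv Ka); first exact: b0.
  by rewrite bK//; move: h2; rewrite /d2 es; lra.
- move=> r s r0 rs; have s0 := le_trans r0 (ltW rs).
  by apply: (Kinfty_lt_inv Ka); [exact: b0|rewrite !bK].
- by rewrite -a0 aK.
- move=> M; exists (a (Num.max 0 M + 1)).
    by rewrite (Kinfty_ge0 Ka)// addr_ge0// le_max lexx.
  rewrite aK ?addr_ge0// ?le_max ?lexx//.
  apply: le_lt_trans (_ : Num.max 0 M < _); last by rewrite ltrDl.
  by rewrite le_max lexx orbT.
Unshelve. all: by end_near. Qed.

End Kinfty.

(** * Domination, and its conversion into comparison functions of class K-infinity *)

Section domination.
Context {R : realType} {X : Type}.
Implicit Types (g h : X -> R).

Definition dominated h g :=
  (forall e, 0 < e -> exists2 d, 0 < d & forall x, g x < d -> h x < e) /\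
  (forall M, exists K, forall x, g x <= M -> h x <= K).

Lemma dominated_trans g h k : dominated g h -> dominated h k -> dominated g k.
Proof.
move=> [gh gh'] [hk hk']; split=> [e /gh[d /hk[c c0 ck] dg]|M].
  by exists c => // x /ck/dg.
have [K KP] := hk' M; have [L LP] := gh' K.
by exists L => x /KP/LP.
Qed.

Lemma dominatedD g h k :
  dominated g k -> dominated h k -> dominated (fun x => g x + h x) k.
Proof.
move=> [gk gk'] [hk hk']; split=> [e e0|M].
  have e2 : 0 < e / 2 by rewrite divr_gt0.
  have [c c0 cP] := gk _ e2; have [d d0 dP] := hk _ e2.
  exists (Num.min c d); first by rewrite lt_min c0.
  by move=> x; rewrite lt_min => /andP[/cP ? /dP ?]; lra.
have [K KP] := gk' M; have [L LP] := hk' M.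
by exists (K + L) => x xM; rewrite lerD ?KP ?LP.
Qed.

Lemma dominated_le g h : (forall x, g x <= h x) -> dominated g h.
Proof.
move=> gh; split=> [e e0|M]; first by exists e => // x; apply: le_lt_trans.
by exists M => x; apply: le_trans.
Qed.

Lemma dominatedZ (c : R) g : 0 < c -> dominated (fun x => c * g x) g.
Proof.
move=> c0; split=> [e e0|M].
  exists (e / c); first by rewrite divr_gt0.
  by move=> x; rewrite ltr_pdivlMr// mulrC.
by exists (c * M) => x; rewrite ler_pM2l.
Qed.

Lemma dominated_sqr g : (forall x, 0 <= g x) -> dominated g (fun x => g x ^+ 2).
Proof.
move=> g0; split=> [e e0|M].
  exists (e ^+ 2); first exact: exprn_gt0.
  by move=> x; rewrite ltr_pXn2r ?nnegrE ?(ltW e0).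
(* A number above both 1 and [M] has a square above [M]. *)
exists (Num.max M 1) => x gM; rewrite leNgt; apply/negP.
by rewrite gt_max => /andP[? ?]; nra.
Qed.

Lemma dominated_Kinfty b g : class_Kinfty b -> (forall x, 0 <= g x) ->
  dominated (b \o g) g.
Proof.
move=> Kb g0; split=> [e e0|M].
  have [d d0 bd] := Kinfty_surj Kb (ltW e0).
  have {}d0 : 0 < d.
    rewrite lt_neqAle d0 andbT; apply/eqP => d_eq0.
    by move: bd e0; rewrite -d_eq0; case: Kb => _ _ -> _ <-; rewrite ltxx.
  by exists d => // x gd; rewrite /= -bd; case: Kb => _ /(_ _ _ (g0 x) gd).
exists (b M) => x gM; exact: Kinfty_le.
Qed.

Lemma dominated_lower h g (x0 : X) :
  (forall x, 0 <= h x) -> (forall x, 0 <= g x) -> dominated h g ->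
  exists a, [/\ class_Kinfty a, continuous a & forall x, a (h x) <= g x].
Proof.
(* a(r) = r / (1 + r) * inf_x (g x + max(0, r - h x)): the infimum is
   nondecreasing and 1-Lipschitz in r, and it is at most g x at r = h x;
   domination makes it positive and unbounded, and the factor r / (1 + r) makes
   the product strictly increasing. *)
move=> h0 g0 [hg hg'].
pose G r x := g x + Num.max 0 (r - h x).
have max0 (r : R) : 0 <= Num.max 0 r by rewrite le_max lexx.
have G0 r x : 0 <= G r x by rewrite addr_ge0.
pose m r := inf (range (G r)).
have m_le r x : m r <= G r x.
  by apply: ge_inf; [exists 0 => _ [y _ <-]|exists x].
(* The point [x0] makes the range nonempty, so that its infimum is a greatest lower bound. *)
have le_m r c : (forall x, c <= G r x) -> c <= m r.
  by move=> cG; apply: lb_le_inf; [exists (G r x0), x0|move=> _ [y _ <-]].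
have m0 r : 0 <= m r by apply: le_m.
have m_mono r s : r <= s -> m r <= m s.
  move=> rs; apply: le_m => x; apply: le_trans (m_le r x) _.
  by rewrite lerD2l ge_max max0 /= le_max lerD2r rs orbT.
have m_lip r s : r <= s -> m s <= m r + (s - r).
  move=> rs; rewrite -lerBlDr; apply: le_m => x; rewrite lerBlDr.
  apply: le_trans (m_le s x) _; rewrite /G -addrA lerD2l ge_max; apply/andP.
  split; first by rewrite addr_ge0// subr_ge0.
  have : r - h x <= Num.max 0 (r - h x) by rewrite le_max lexx orbT.
  lra.
have m_cont : continuous m.
  move=> r; apply/cvgrPdist_lt => e e0; near=> s.
  have : `|r - s| < e by near: s; apply: cvgr_dist_lt.
  apply: le_lt_trans; case: (leP r s) => rs.
    rewrite ler0_norm ?subr_le0 ?m_mono// ler0_norm ?subr_le0//.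
    by have := m_lip _ _ rs; lra.
  have {}rs := ltW rs.
  rewrite ger0_norm ?subr_ge0 ?m_mono// ger0_norm ?subr_ge0//.
  by have := m_lip _ _ rs; lra.
have m_gt0 s : 0 < s -> 0 < m s.
  move=> s0; have s2 : 0 < s / 2 by rewrite divr_gt0.
  have [d d0 dP] := hg _ s2.
  (* Either [g x >= d], or [h x < s / 2] and the penalty [s - h x] exceeds [s / 2]. *)
  apply: lt_le_trans (_ : Num.min d (s / 2) <= _); first by rewrite lt_min d0.
  apply: le_m => x; rewrite ge_min; case: (leP d (g x)) => [dg|/dP hs].
    by rewrite (le_trans dg)// lerDl.
  apply/orP; right; rewrite /G.
  have : s - h x <= Num.max 0 (s - h x) by rewrite le_max lexx orbT.
  by have := g0 x; lra.
(* The absolute value keeps the denominator positive, which gives continuity on the whole line. *)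
pose q (r : R) := r / (1 + `|r|).
have den r : 0 < 1 + `|r| :> R by rewrite ltr_pwDl.
have qE r : 0 <= r -> q r = r / (1 + r) by move=> r0; rewrite /q ger0_norm.
have qm_cont : continuous (fun r => q r * m r).
  move=> r; apply: cvgM; last exact: m_cont.
  apply: cvgM; first exact: cvg_id.
  apply: cvgV; first by rewrite gt_eqF.
  by apply: cvgD; [exact: cvg_cst|exact: norm_continuous].
exists (fun r => q r * m r); split=> //.
- split.
  + exact: continuous_subspaceT.
  + move=> r s r0 rs; have s0 := le_lt_trans r0 rs.
    rewrite !qE ?(ltW s0)//.
    apply: le_lt_trans (_ : r / (1 + r) * m s < _).
      by rewrite ler_wpM2l ?m_mono ?(ltW rs)// divr_ge0// addr_ge0.
    rewrite ltr_pM2r ?m_gt0// ltr_pdivrMr ?ltr_pwDl// mulrAC.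
    rewrite ltr_pdivlMr ?ltr_wpDr//.
      by nra.
    by lra.
  + by rewrite /q mul0r mul0r.
  (* The factor 2 in [N] compensates [q r >= 1/2], which holds for [r >= 1]. Where [g x <= N], the
     choice [r >= K + N] makes the penalty at least [N]. *)
  + move=> M; pose N := 2 * (`|M| + 1).
    have [K KP] := hg' N.
    pose r := Num.max 1 (K + N).
    have r1 : 1 <= r by rewrite le_max lexx.
    have rK : K + N <= r by rewrite le_max lexx orbT.
    exists r; first by lra.
    have Nm : N <= m r.
      apply: le_m => x; case: (leP (g x) N) => [/KP hK|/ltW gN].
        have : r - h x <= Num.max 0 (r - h x) by rewrite le_max lexx orbT.
        by rewrite /G; have := g0 x; lra.
      by rewrite (le_trans gN)// lerDl.
    have q2 : 2^-1 <= q r.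
      by rewrite qE ?ler_pdivlMr; lra.
    apply: lt_le_trans (_ : 2^-1 * N <= _).
      by rewrite /N mulrA mulVf// mul1r; have := ler_norm M; lra.
    by rewrite ler_pM// /N; have := normr_ge0 M; lra.
move=> x; rewrite qE//; apply: le_trans (_ : 1 * m (h x) <= _).
  by rewrite ler_wpM2r// ler_pdivrMr ?mul1r; have := h0 x; lra.
by rewrite mul1r; apply: le_trans (m_le _ x) _; rewrite /G subrr maxxx addr0.
Unshelve. all: by end_near. Qed.

(** Applying the inverse of [a] to [a (h x) <= g x] gives the bound. *)
Lemma dominated_upper h g (x0 : X) :
  (forall x, 0 <= h x) -> (forall x, 0 <= g x) -> dominated h g ->
  exists2 b, class_Kinfty b & forall x, h x <= b (g x).
Proof.
move=> h0 g0 hg; have [a [Ka _ ah]] := dominated_lower x0 h0 g0 hg.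
have [b Kb bK] := Kinfty_inverse Ka.
exists b => // x; rewrite -[leLHS]bK//.
by apply: Kinfty_le => //; exact: Kinfty_ge0.
Qed.

End domination.

Lemma dominated_comp {R : realType} {X Y : Type} (p : Y -> X) (g h : X -> R) :
  dominated g h -> dominated (g \o p) (h \o p).
Proof.
move=> [gh gh']; split=> [e /gh[d d0 dP]|M]; first by exists d => // y /dP.
by have [K KP] := gh' M; exists K => y /KP.
Qed.

(** * The Euclidean norm, and domination for continuous maps *)

Section enorm.
Context {R : realType}.

Lemma enorm_ge0 n (v : 'cV[R]_n) : 0 <= enorm v.
Proof. exact: sqrtr_ge0. Qed.

Lemma enorm_sqr n (v : 'cV[R]_n) : enorm v ^+ 2 = \sum_(i < n) v i ord0 ^+ 2.
Proof. by rewrite sqr_sqrtr// sumr_ge0// => i _; exact: sqr_ge0. Qed.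

Lemma enorm0 n : enorm (0 : 'cV[R]_n) = 0.
Proof.
by rewrite /enorm big1 ?sqrtr0// => i _; rewrite mxE expr0n.
Qed.

(** Links the sup-norm topology to [enorm]: a Euclidean ball lies in the sup-norm ball of the same
    radius. *)
Lemma normr_le_enorm n (v : 'cV[R]_n) : `|v| <= enorm v.
Proof.
rewrite [leLHS]/Num.Def.normr/= mx_normrE.
apply/bigmax_leP; split => [|[i j] _].
  exact: enorm_ge0.
rewrite /= (ord1 j) -(@ler_pXn2r _ 2)// ?nnegrE ?enorm_ge0//.
rewrite enorm_sqr real_normK ?num_real// (bigD1 i)//= lerDl.
by rewrite sumr_ge0// => k _; exact: sqr_ge0.
Qed.

Lemma enorm_continuous n : continuous (@enorm R n).
Proof.
move=> v; apply: (@continuous_comp _ _ _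
  (fun u : 'cV[R]_n => \sum_(i < n) u i ord0 ^+ 2) Num.sqrt); last first.
  exact: sqrt_continuous.
apply: continuous_big => [|i _]; first exact: add_continuous.
move=> u; apply: (@continuous_comp _ _ _ (fun u : 'cV[R]_n => u i ord0)
  (fun r : R => r ^+ 2)); first exact: coord_continuous.
exact: exprn_continuous.
Qed.

Lemma enorm_col_mx_sqr n p (u : 'cV[R]_n) (v : 'cV[R]_p) :
  enorm (col_mx u v) ^+ 2 = enorm u ^+ 2 + enorm v ^+ 2.
Proof.
rewrite !enorm_sqr big_split_ord/=; congr (_ + _); apply: eq_bigr => i _.
  by rewrite col_mxEu.
by rewrite col_mxEd.
Qed.

Lemma enorm_col_mx_le n p (u : 'cV[R]_n) (v : 'cV[R]_p) :
  enorm (col_mx u v) <= enorm u + enorm v.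
Proof.
have u0 := enorm_ge0 u; have v0 := enorm_ge0 v.
rewrite -(@ler_pXn2r _ 2)// ?nnegrE ?enorm_ge0 ?addr_ge0//.
by rewrite enorm_col_mx_sqr; nra.
Qed.

Lemma enorm_le_col_mxl n p (u : 'cV[R]_n) (v : 'cV[R]_p) :
  enorm u <= enorm (col_mx u v).
Proof.
rewrite -(@ler_pXn2r _ 2)// ?nnegrE ?enorm_ge0//.
by rewrite enorm_col_mx_sqr lerDl sqr_ge0.
Qed.

Lemma enorm_le_col_mxr n p (u : 'cV[R]_n) (v : 'cV[R]_p) :
  enorm v <= enorm (col_mx u v).
Proof.
rewrite -(@ler_pXn2r _ 2)// ?nnegrE ?enorm_ge0//.
by rewrite enorm_col_mx_sqr lerDr sqr_ge0.
Qed.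

Lemma trmx_continuous n p : continuous (@trmx R n p).
Proof.
move=> A s /= /(nbhs_ballP A^T)[e e0 es].
apply/nbhs_ballP; exists e => //= B [_ AB]; apply: es; split=> // i j.
by rewrite !mxE; exact: AB.
Qed.

Lemma enorm_continuous_bounded n p (F : 'cV[R]_n -> 'cV[R]_p) (M : R) :
  continuous F -> exists K, forall z, enorm z <= M -> enorm (F z) <= K.
Proof.
(* [bounded_closed_compact] concerns row vectors, so the compact ball consists of rows and [F] is
   precomposed with transposition. *)
move=> cF; pose B := [set v : 'rV[R]_n | `|v| <= M].
have cB : compact B.
  apply: bounded_closed_compact.
    exists M; split=> [|L ML v /= vM]; first exact: num_real.
    exact: le_trans vM (ltW ML).
  rewrite (_ : B = Num.Def.normr @^-1` [set x | x <= M])//.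
  by apply: closed_comp => [x _|]; [exact: norm_continuous|exact: closed_le].
have : compact [set enorm (F v^T) | v in B].
  apply: continuous_compact cB; apply: continuous_subspaceT => v.
  apply: (@continuous_comp _ _ _ (fun v : 'rV[R]_n => F v^T)).
    by apply: continuous_comp; [exact: trmx_continuous|exact: cF].
  exact: enorm_continuous.
(* Every number strictly above [L] is a bound; [L + 1] is one. *)
move=> /compact_bounded[L [_ /(_ (L + 1))]]; rewrite ltrDl ltr01 => /(_ isT) LB.
exists (L + 1) => z zM; apply: le_trans (ler_norm _) _; apply: LB.
exists z^T; last by rewrite trmxK.
apply: le_trans zM; apply: le_trans (normr_le_enorm z).
rewrite /Num.Def.normr/= !mx_normrE; apply/bigmax_leP; split => [|[i j] _].
  by apply: bigmax_ge_id.
by apply: le_trans (le_bigmax _ _ (j, i)); rewrite mxE.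
Qed.

(** Smallness is continuity at 0 together with [F 0 = 0]; boundedness is compactness of closed
    balls. *)
Lemma dominated_enorm_continuous n p (F : 'cV[R]_n -> 'cV[R]_p) :
  continuous F -> F 0 = 0 -> dominated (fun z => enorm (F z)) (@enorm R n).
Proof.
move=> cF F0; split=> [e e0|M]; last exact: enorm_continuous_bounded.
have /cvgrPdist_lt/(_ _ e0) :
    enorm (F z) @[z --> (0 : 'cV[R]_n)] --> enorm (F 0).
  by apply: continuous_comp; [exact: cF|exact: enorm_continuous].
rewrite F0 enorm0 => /nbhs_ballP[d /= d0 dP].
exists d => // z zd; rewrite -[enorm _]ger0_norm ?enorm_ge0// -normrN -sub0r.
apply: dP; rewrite -ball_normE /= sub0r normrN.
exact: le_lt_trans (normr_le_enorm z) zd.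
Qed.

(** The previous lemma for the inverse map, evaluated at [T z]. *)
Lemma dominated_change_of_coordinates n (T : 'cV[R]_n -> 'cV[R]_n) :
  change_of_coordinates T ->
  dominated (@enorm R n) (fun z => enorm (T z)).
Proof.
move=> [T0 [Tinv [TK _ _ cTinv]]].
have Tinv0 : Tinv 0 = 0 by rewrite -[in LHS]T0 TK.
have [near0 bnd] := dominated_enorm_continuous cTinv Tinv0.
split=> [e /near0[d d0 dP]|M]; first by exists d => // z /dP; rewrite TK.
by have [K KP] := bnd M; exists K => z /KP; rewrite TK.
Qed.

End enorm.

(** * Continuity, measurability and integration on forward time *)

Section forward_time.
Context {R : realType}.
Implicit Types (t : R) (g h : R -> R).

(* Continuity on [0, +oo[, expressed on the whole line so that it composes
   without subspace topologies. *)
Definition forward_continuous (U : topologicalType) (g : R -> U) :=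
  continuous (g \o Num.max 0).

Lemma forward_continuous_comp (U V : topologicalType)
    (F : U -> V) (g : R -> U) :
  continuous F -> forward_continuous g -> forward_continuous (F \o g).
Proof.
move=> cF cg s; apply: (@continuous_comp _ _ _ (g \o Num.max 0) F).
  exact: cg.
exact: cF.
Qed.

Lemma forward_continuousD g h :
  forward_continuous g -> forward_continuous h ->
  forward_continuous (fun s => g s + h s).
Proof.
by move=> cg ch s; apply: cvgD; [exact: cg|exact: ch].
Qed.

(** On nonnegative times [g] agrees with its clamped version, which is continuous and hence Borel;
    [sub_caratheodory] passes from Borel to Lebesgue-measurable sets. *)
Lemma measurable_forward g : forward_continuous g ->
  measurable_fun [set s : lebesgueR R | 0 <= s]
    (g : lebesgueR R -> measurableTypeR R).
Proof.
move=> cg; apply: (@eq_measurable_fun _ _ _ _ _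
  (g \o Num.max 0 : lebesgueR R -> measurableTypeR R)).
  by move=> s; rewrite inE /= => s0; rewrite max_r.
move=> mD Y mY; apply: measurableI => //; apply: sub_caratheodory.
have := continuous_measurable_fun cg measurableT mY.
by rewrite setTI.
Qed.

Lemma measurable_time_interval t :
  measurable [set s : lebesgueR R | 0 <= s <= t].
Proof.
apply: sub_caratheodory.
rewrite (_ : [set _ | _] = [set` `[0, t]]); first exact: measurable_itv.
by apply/seteqP; split => s /=; rewrite in_itv.
Qed.

Lemma measurable_time_integrand t g : forward_continuous g ->
  measurable_fun [set s : lebesgueR R | 0 <= s <= t]
    (g : lebesgueR R -> measurableTypeR R).
Proof.
move=> cg; apply: (@measurable_funS _ _ _ _ [set s : lebesgueR R | 0 <= s]).
- apply: sub_caratheodory.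
  rewrite (_ : [set _ | _] = [set` `[0, +oo[]); first exact: measurable_itv.
  by apply/seteqP; split => s /=; rewrite in_itv/= andbT.
- by move=> s /= /andP[].
- exact: measurable_forward.
Qed.

Lemma forward_continuous_bounded t g : forward_continuous g ->
  exists M, forall s, 0 <= s <= t -> g s <= M.
Proof.
move=> cg; case: (leP 0 t) => [t0|t0]; last first.
  (* For negative [t] the interval is empty, so any bound will do. *)
  exists 0 => s /andP[s0 st]; have := le_lt_trans (le_trans s0 st) t0.
  by rewrite ltxx.
have [|c _ cP] := @EVT_max R (g \o Num.max 0) 0 t t0.
  exact: continuous_subspaceT.
exists (g (Num.max 0 c)) => s /[dup] /andP[s0 _] st.
by have := cP s; rewrite in_itv/= max_r//; exact.
Qed.

Lemma time_int_ge0 t g : (forall s, 0 <= g s) -> (0 <= time_int t g)%E.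
Proof. by move=> g0; apply: integral_ge0 => s _; rewrite lee_fin. Qed.

(** The integrand is bounded on a set of finite measure. This finiteness is what allows the returned
    integral to be absorbed in the small-gain step. *)
Lemma time_int_fin_num t g : forward_continuous g -> (forall s, 0 <= g s) ->
  time_int t g \is a fin_num.
Proof.
move=> cg g0; rewrite ge0_fin_numE ?time_int_ge0//.
apply: integrable_lty; first exact: measurable_time_interval.
apply: measurable_bounded_integrable.
- exact: measurable_time_interval.
(* Both measures take the outer measure of the interval as value, hence are convertible here. *)
- change (@lebesgue_measure R [set s : R | (0 <= s <= t)%R] < +oo)%E.
  rewrite (_ : [set _ | _] = [set` `[0, t]] :> set R); last first.
    by apply/seteqP; split => s /=; rewrite in_itv.
  by rewrite lebesgue_measure_itv/=; case: ifP => // _; rewrite -EFinB ltry.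
- exact: measurable_time_integrand.
- have [M MP] := forward_continuous_bounded t cg.
  exists M; split=> [|L ML s /= st]; first exact: num_real.
  by rewrite ger0_norm// (le_trans (MP _ st))// ltW.
Qed.

Lemma time_int_le t g h : forward_continuous g -> forward_continuous h ->
  (forall s, 0 <= g s) -> (forall s, 0 <= s -> g s <= h s) ->
  (time_int t g <= time_int t h)%E.
Proof.
move=> cg ch g0 gh; apply: ge0_le_integral.
- exact: measurable_time_interval.
- by move=> s _; rewrite lee_fin.
- by apply/measurable_EFinP; exact: measurable_time_integrand.
- by apply/measurable_EFinP; exact: measurable_time_integrand.
- by move=> s /= /andP[s0 _]; rewrite lee_fin gh.
Qed.

Lemma time_intD t g h : forward_continuous g -> forward_continuous h ->
  (forall s, 0 <= g s) -> (forall s, 0 <= h s) ->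
  (time_int t (fun s => g s + h s)%R = time_int t g + time_int t h)%E.
Proof.
move=> cg ch g0 h0; rewrite /time_int -ge0_integralD//.
- exact: measurable_time_interval.
- by move=> s _; rewrite lee_fin.
- by apply/measurable_EFinP; exact: measurable_time_integrand.
- by move=> s _; rewrite lee_fin.
- by apply/measurable_EFinP; exact: measurable_time_integrand.
Qed.

Lemma time_intZ t g (c : R) : forward_continuous g ->
  (forall s, 0 <= g s) -> 0 <= c ->
  (time_int t (fun s => c * g s)%R = c%:E * time_int t g)%E.
Proof.
move=> cg g0 c0; rewrite /time_int -ge0_integralZl_EFin//.
- exact: measurable_time_interval.
- by move=> s _; rewrite lee_fin.
- by apply/measurable_EFinP; exact: measurable_time_integrand.
Qed.

(** Absolute continuity restricted to families of a single interval is uniform continuity. *)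
Lemma solution_forward_continuous n m
    (f : 'cV[R]_n -> 'cV[R]_m -> 'cV[R]_n) w x :
  solution f w x -> forward_continuous x.
Proof.
move=> [acx _] s; apply/cvgrPdist_lt => e e0.
have max0 (r : R) : 0 <= Num.max 0 r by rewrite le_max lexx.
(* The extra 1 leaves room to the right of [s]: times within distance 1 stay in the interval where
   absolute continuity is invoked. *)
have b0 : 0 <= Num.max 0 s + 1 by rewrite addr_ge0.
have [d d0 dP] := acx _ b0 e e0.
have step u v : 0 <= u -> u <= v -> v <= Num.max 0 s + 1 -> v - u < d ->
    `|x v - x u| < e.
  move=> u0 uv vb uvd.
  have := dP 1 (fun=> u) (fun=> v); rewrite !big_ord1 => xe.
  apply: le_lt_trans (normr_le_enorm _) (xe _ _ uvd).
    by move=> _; rewrite u0 uv.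
  by move=> k k'; rewrite !ord1 eqxx.
near=> r.
have : `|Num.max 0 s - Num.max 0 r| < Num.min d 1.
  apply: le_lt_trans (maxr0_dist _ _) _; near: r.
  by apply: cvgr_dist_lt; [exact: cvg_id|rewrite lt_min d0/=].
rewrite lt_min => /andP[sd s1].
case: (leP (Num.max 0 s) (Num.max 0 r)) => sr.
  rewrite /= distrC; move: sd s1; rewrite ler0_norm ?subr_le0// opprB => sd s1.
  by apply: step => //; lra.
move: sd s1; rewrite gtr0_norm ?subr_gt0// => sd s1.
by apply: step => //; [exact: ltW|lra].
Unshelve. all: by end_near. Qed.

(** Makes each trajectory of the loop an admissible input of the other system, so that the gain
    bounds apply to it. *)
Lemma forward_continuous_input_class n (x : R -> 'cV[R]_n) :
  forward_continuous x -> input_class x.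
Proof.
move=> cx; split=> [i|b].
  apply: measurable_forward.
  exact: (forward_continuous_comp (@coord_continuous _ _ _ i ord0)).
have [M MP] := forward_continuous_bounded b
  (forward_continuous_comp (@enorm_continuous R n) cx).
by exists M; apply: aeW => s; exact: MP.
Qed.

End forward_time.

(** * The small-gain inequality and the comparison of L2 norms *)

(** If one integral is bounded by its [b], the other is bounded by its own [b] or by substitution,
    whence the factors [1 + c1] and [1 + c2]. Otherwise [I1 <= c1 * c2 * I1] forces [I1 = 0], and
    then [I2 = 0]. *)
Lemma small_gain (R : realType) (I1 I2 b1 b2 c1 c2 : R) :
  0 <= I1 -> 0 <= I2 -> 0 <= b1 -> 0 <= b2 -> 0 < c1 -> 0 < c2 ->
  c1 * c2 < 1 ->
  I1 <= Num.max b1 (c2 * I2) -> I2 <= Num.max b2 (c1 * I1) ->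
  I1 + I2 <= (1 + c1) * b1 + (1 + c2) * b2.
Proof.
move=> I10 I20 b10 b20 c10 c20 c12; rewrite !le_max.
move=> /orP[I1b|I1I] /orP[I2b|I2I]; try by nra.
have I1c : I1 <= c1 * c2 * I1.
  by rewrite mulrAC mulrC (le_trans I1I)// ler_pM2l.
have I1_eq0 : I1 = 0 by nra.
by move: I2I; rewrite I1_eq0; nra.
Qed.

Lemma sqnormL2_forward_continuous (R : realType) n p
    (F : 'cV[R]_n -> 'cV[R]_p) (x : R -> 'cV[R]_n) :
  continuous F -> forward_continuous x ->
  forward_continuous (fun s => enorm (F (x s)) ^+ 2).
Proof.
move=> cF; apply: (@forward_continuous_comp _ _ _ (fun z => enorm (F z) ^+ 2)).
move=> z.
apply: (@continuous_comp _ _ _ (fun z => enorm (F z)) (fun r => r ^+ 2)).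
  by apply: continuous_comp; [exact: cF|exact: enorm_continuous].
exact: exprn_continuous.
Qed.

Lemma change_of_coordinates_continuous (R : realType) n
    (T : 'cV[R]_n -> 'cV[R]_n) :
  change_of_coordinates T -> continuous T.
Proof. by move=> [_ [Tinv []]]. Qed.

(** Closes the loop: the input term of one gain bound becomes [c] times the state term of the other,
    [c] being the square of [Num.sqrt c]. *)
Lemma sqnormL2_le (R : realType) n (S T : 'cV[R]_n -> 'cV[R]_n) (c : R) t
    (x : R -> 'cV[R]_n) :
  continuous S -> continuous T -> 0 <= c ->
  (forall z, enorm (S z) <= Num.sqrt c * enorm (T z)) ->
  forward_continuous x ->
  (sqnormL2 t (S \o x) <= c%:E * sqnormL2 t (T \o x))%E.
Proof.
move=> cS cT c0 ST cx.
have cTx := sqnormL2_forward_continuous cT cx.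
rewrite -time_intZ//; last by move=> s; exact: sqr_ge0.
apply: time_int_le.
- exact: sqnormL2_forward_continuous.
- exact: (forward_continuous_comp (@mulrl_continuous _ c)).
- by move=> s; exact: sqr_ge0.
move=> s _ /=; rewrite -(sqr_sqrtr c0) -exprMn.
by rewrite ler_pXn2r ?nnegrE ?mulr_ge0 ?sqrtr_ge0 ?enorm_ge0.
Qed.

(** * Assembly of the estimates along feedback trajectories *)

Theorem theorem7 (R : realType) (n1 n2 : nat)
    (f1 : 'cV[R]_n1 -> 'cV[R]_n2 -> 'cV[R]_n1)
    (f2 : 'cV[R]_n2 -> 'cV[R]_n1 -> 'cV[R]_n2)
    (lip1 : locally_lipschitz_state f1)
    (lip2 : locally_lipschitz_state f2)
    (fc1 : forward_complete f1)
    (fc2 : forward_complete f2)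
    (alpha1 beta1 sigma1 alpha2 beta2 sigma2 : R -> R)
    (Kalpha1 : class_Kinfty alpha1) (Kbeta1 : class_Kinfty beta1)
    (Ksigma1 : class_Kinfty sigma1)
    (Kalpha2 : class_Kinfty alpha2) (Kbeta2 : class_Kinfty beta2)
    (Ksigma2 : class_Kinfty sigma2)
    (ISS1 : ISS_with f1 alpha1 beta1 sigma1)
    (ISS2 : ISS_with f2 alpha2 beta2 sigma2)
    (fc12 : feedback_forward_complete f1 f2)
    (T1 : 'cV[R]_n1 -> 'cV[R]_n1) (S1 : 'cV[R]_n2 -> 'cV[R]_n2)
    (T2 : 'cV[R]_n2 -> 'cV[R]_n2) (S2 : 'cV[R]_n1 -> 'cV[R]_n1)
    (ccT1 : change_of_coordinates T1) (ccS1 : change_of_coordinates S1)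
    (ccT2 : change_of_coordinates T2) (ccS2 : change_of_coordinates S2)
    (hbeta1 hbeta2 : R -> R)
    (Khbeta1 : class_Kinfty hbeta1) (Khbeta2 : class_Kinfty hbeta2)
    (gain1 : unit_L2_gain_in f1 T1 S1 hbeta1)
    (gain2 : unit_L2_gain_in f2 T2 S2 hbeta2)
    (c1 c2 : R) (c1_gt0 : 0 < c1) (c2_gt0 : 0 < c2)
    (S2T1 : forall z : 'cV[R]_n1, enorm (S2 z) <= Num.sqrt c1 * enorm (T1 z))
    (S1T2 : forall z : 'cV[R]_n2, enorm (S1 z) <= Num.sqrt c2 * enorm (T2 z))
    (c1c2_lt1 : c1 * c2 < 1) :
  feedback_alpha_integrable f1 f2.
Proof.
have cT1 := change_of_coordinates_continuous ccT1.
have cT2 := change_of_coordinates_continuous ccT2.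
have cS1 := change_of_coordinates_continuous ccS1.
have cS2 := change_of_coordinates_continuous ccS2.
pose X := ('cV[R]_n1 * 'cV[R]_n2)%type.
(* [h] is the norm of the joint state, [V] the integrand to be bounded, and [B] the right-hand side
   of [small_gain] as a function of the initial state. *)
pose h (p : X) := enorm (col_mx p.1 p.2).
pose V (p : X) := enorm (T1 p.1) ^+ 2 + enorm (T2 p.2) ^+ 2.
pose B (p : X) := (1 + c1) * hbeta1 (enorm (T1 p.1)) +
                  (1 + c2) * hbeta2 (enorm (T2 p.2)).
have h0 p : 0 <= h p := enorm_ge0 _.
have V0 p : 0 <= V p by rewrite addr_ge0 ?sqr_ge0.
have b10 p : 0 <= hbeta1 (enorm (T1 p)).
  by rewrite (Kinfty_ge0 Khbeta1) ?enorm_ge0.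
have b20 p : 0 <= hbeta2 (enorm (T2 p)).
  by rewrite (Kinfty_ge0 Khbeta2) ?enorm_ge0.
have B0 p : 0 <= B p by rewrite addr_ge0// mulr_ge0// addr_ge0// ltW.
(* Each component is dominated by its image under [T], that norm by its square, and the square by
   [V]. *)
have hV : dominated h V.
  have D n (T : 'cV[R]_n -> 'cV[R]_n) (p : X -> 'cV[R]_n) :
      change_of_coordinates T -> (forall q, enorm (T (p q)) ^+ 2 <= V q) ->
      dominated (fun q => enorm (p q)) V.
    move=> ccT TV.
    apply: dominated_trans
      (dominated_comp p (dominated_change_of_coordinates ccT)) _.
    apply: dominated_trans (dominated_le TV).
    by apply: dominated_sqr => q; exact: enorm_ge0.
  apply: (dominated_trans (dominated_le (fun p => enorm_col_mx_le p.1 p.2))).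
  apply: dominatedD; first by apply: (D _ T1) => // q; rewrite lerDl sqr_ge0.
  by apply: (D _ T2) => // q; rewrite lerDr sqr_ge0.
have Bh : dominated B h.
  have D n (T : 'cV[R]_n -> 'cV[R]_n) b c (p : X -> 'cV[R]_n) :
      change_of_coordinates T -> class_Kinfty b -> 0 < c ->
      (forall q, enorm (p q) <= h q) ->
      dominated (fun q => (1 + c) * b (enorm (T (p q)))) h.
    move=> ccT Kb c0 ph.
    apply: dominated_trans (dominatedZ _ _) _; first by rewrite addr_gt0.
    apply: dominated_trans (dominated_Kinfty Kb _) _.
      by move=> q; exact: enorm_ge0.
    apply: dominated_trans (dominated_le ph).
    apply: (dominated_comp p (dominated_enorm_continuous _ _)).
      exact: change_of_coordinates_continuous.
    by case: ccT.
  apply: dominatedD.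
    by apply: (D _ T1 hbeta1 c1 fst) => // q; exact: enorm_le_col_mxl.
  by apply: (D _ T2 hbeta2 c2 snd) => // q; exact: enorm_le_col_mxr.
(* The pair [(0, 0)] only witnesses that the state space is inhabited. *)
have [a [Ka ca aV]] := dominated_lower (0, 0) h0 V0 hV.
have [b Kb Bb] := dominated_upper (0, 0) B0 h0 Bh.
exists a, b; split=> // x1 x2 [sol1 sol2] x t t0.
have cx1 := solution_forward_continuous sol1.
have cx2 := solution_forward_continuous sol2.
have cT1x := sqnormL2_forward_continuous cT1 cx1.
have cT2x := sqnormL2_forward_continuous cT2 cx2.
have I1_fin : sqnormL2 t (T1 \o x1) \is a fin_num.
  by apply: time_int_fin_num => // s; exact: sqr_ge0.
have I2_fin : sqnormL2 t (T2 \o x2) \is a fin_num.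
  by apply: time_int_fin_num => // s; exact: sqr_ge0.
have I1_ge0 : (0 <= sqnormL2 t (T1 \o x1))%E.
  by apply: time_int_ge0 => s; exact: sqr_ge0.
have I2_ge0 : (0 <= sqnormL2 t (T2 \o x2))%E.
  by apply: time_int_ge0 => s; exact: sqr_ge0.
have I1 := gain1 _ _ (forward_continuous_input_class cx2) sol1 _ t0.
have I2 := gain2 _ _ (forward_continuous_input_class cx1) sol2 _ t0.
have {}I1 := le_trans I1 (le_max2 (lexx _)
  (sqnormL2_le t cS1 cT2 (ltW c2_gt0) S1T2 cx2)).
have {}I2 := le_trans I2 (le_max2 (lexx _)
  (sqnormL2_le t cS2 cT1 (ltW c1_gt0) S2T1 cx1)).
(* Since both integrals are finite, the bounds can be read in the reals, where [small_gain]
   applies. *)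
have VB : (time_int t (fun s => V (x1 s, x2 s)) <= (B (x1 0, x2 0))%:E)%E.
  rewrite time_intD//; [|by move=> s; exact: sqr_ge0..].
  move: I1 I2 I1_ge0 I2_ge0.
  rewrite -/(sqnormL2 t (T1 \o x1)) -/(sqnormL2 t (T2 \o x2)).
  rewrite -(fineK I1_fin) -(fineK I2_fin) -!EFinM -!EFin_max !lee_fin.
  by move=> ? ? ? ?; apply: small_gain.
have cx : forward_continuous (fun s => enorm (x s)).
  rewrite (_ : (fun s => _) =
      Num.sqrt \o (fun s => enorm (x1 s) ^+ 2 + enorm (x2 s) ^+ 2)).
    apply: forward_continuous_comp; first exact: sqrt_continuous.
    apply: forward_continuousD.
      by apply: (@sqnormL2_forward_continuous _ _ _ id) => // z; exact: cvg_id.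
    by apply: (@sqnormL2_forward_continuous _ _ _ id) => // z; exact: cvg_id.
  apply/funext => s /=.
  by rewrite -enorm_col_mx_sqr sqrtr_sqr ger0_norm ?enorm_ge0.
(* What remains is [a (h x) <= V x] under the integral; [B <= b (h)] is used at the initial
   state. *)
apply: le_trans (le_trans VB _); last by rewrite lee_fin.
apply: time_int_le.
- exact: forward_continuous_comp cx.
- exact: forward_continuousD.
- by move=> s; rewrite (Kinfty_ge0 Ka)// enorm_ge0.
- by move=> s _; exact: aV (x1 s, x2 s).
Qed.
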